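(* Let $N\ge2$ and $1^*=\frac N{N-1}$. Let $a>0$ be such that $w:=a\chi_B$, where $B$ is a unit ball in $\mathbb{R}^N$, is a maximizer for the problem $$c_0=\sup_{u\in\dot{BV}(\mathbb{R}^N):\,\|Du\|=1}\int_{\mathbb{R}^N}|u|^{1^*},$$ and for $R>0$ put $w_R:=R^{1-N}a\chi_{B_R}$, where $B_R$ is a ball of radius $R$ (by scaling invariance, $w_R$ is then also a maximizer). Let the function $F\in C(\mathbb{R})$ be such that the following supremum is positive and is attained: $$0<m=\sup_{s\in\mathbb{R}}\frac{F(s)}{|s|^{1^*}}=\frac{F(t)}{|t|^{1^*}}\quad\text{for some }t\in\mathbb{R}.$$ Then the maximum in the relation $$c=\sup_{u\in\dot{BV}(\mathbb{R}^N):\,\|Du\|=1}\int_{\mathbb{R}^N}F(u)$$ is attained at the point $w_R$ with $R=\left(\frac{a}{t}\right)^{\frac1{N-1}}$.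
   Context: $\dot{BV}(\mathbb{R}^N)$ is the space of all measurable functions $u:\mathbb{R}^N\to\mathbb{R}$ vanishing at infinity (i.e. $|\{x\in\mathbb{R}^N:|u(x)|>\epsilon\}|<\infty$ for every $\epsilon>0$) such that $$\|Du\|:=\sup_{v\in C_0^\infty(\mathbb{R}^N;\mathbb{R}^N),\ \|v\|_\infty=1}\int_{\mathbb{R}^N}u\,\mathrm{div}\,v\,dx<\infty ,$$ where $C_0^\infty$ means smooth with compact support. $\|Du\|$ is the norm of $\dot{BV}(\mathbb{R}^N)$. $\chi_A$ denotes the characteristic function of the set $A$.
   Formalization: For t<0 the radius (a/t)^{1/(N-1)} is not a positive number; there the maximizer is -w_R with R=(a/|t|)^{1/(N-1)}. The supremum is over s≠0 with t≠0, and u is required to be locally integrable so that the integrals of u div v are defined. *)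

(* Defs.v *)
From HB Require Import structures.
From mathcomp Require Import all_boot all_order all_algebra.
From mathcomp Require Import all_classical all_reals all_analysis.
Set Implicit Arguments.
Unset Strict Implicit.
Unset Printing Implicit Defensive.
Import Order.TTheory GRing.Theory Num.Theory.
Import numFieldNormedType.Exports.
Local Open Scope classical_set_scope.
Local Open Scope ring_scope.

(* The library's norm on row vectors is the sup norm, hence this definition. *)
Definition enorm {R : realType} {N : nat} (x : 'rV[R]_N) : R :=
  Num.sqrt (\sum_(i < N) x ord0 i ^+ 2).

Definition eball {R : realType} {N : nat} (x0 : 'rV[R]_N) (r : R) :
    set 'rV[R]_N :=
  [set x | enorm (x - x0) < r].

Definition box {R : realType} {N : nat} (p : 'rV[R]_N * 'rV[R]_N) :
    set 'rV[R]_N :=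
  [set x | forall i, p.1 ord0 i < x ord0 i <= p.2 ord0 i].

Definition box_volume {R : realType} {N : nat} (p : 'rV[R]_N * 'rV[R]_N) : R :=
  \prod_(i < N) Num.max 0 (p.2 ord0 i - p.1 ord0 i).

Definition box_cover {R : realType} {N : nat} (A : set 'rV[R]_N) :
    set (set ('rV[R]_N * 'rV[R]_N)) :=
  [set C | countable C /\ A `<=` \bigcup_(p in C) box p].

Definition lebesgue_outer (R : realType) (N : nat) (A : set 'rV[R]_N) :
    \bar R :=
  ereal_inf [set \esum_(p in C) (box_volume p)%:E | C in box_cover A].

Section lebesgue_outer_measure.
Local Open Scope ereal_scope.
Context {R : realType} {N : nat}.
Implicit Types (p : 'rV[R]_N * 'rV[R]_N) (A : set 'rV[R]_N).
Local Notation vol := (fun p => (box_volume p)%:E).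

Lemma box_volume_ge0 p : (0 <= box_volume p)%R.
Proof. by apply: prodr_ge0 => i _; rewrite le_max lexx. Qed.

Let vol_ge0 p : 0 <= vol p. Proof. by rewrite lee_fin box_volume_ge0. Qed.

Lemma lebesgue_outer_ge0 A : 0 <= lebesgue_outer A.
Proof.
by apply: le_ereal_inf_tmp => _ [C _ <-]; apply: esum_ge0 => p _; exact: vol_ge0.
Qed.

Lemma lebesgue_outer0 : lebesgue_outer (@set0 'rV[R]_N) = 0.
Proof.
apply/eqP; rewrite eq_le lebesgue_outer_ge0 andbT.
apply: ereal_inf_lbound; exists set0; last by rewrite esum_set0.
by split; [exact: countable0|exact: sub0set].
Qed.

Lemma le_lebesgue_outer :
  {homo @lebesgue_outer R N : A B / A `<=` B >-> A <= B}.
Proof.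
move=> A B AB; apply: ereal_inf_le_tmp => _ [C [cC BC] <-].
by exists C => //; split => //; exact: subset_trans AB BC.
Qed.

Let le_esum_set (C D : set ('rV[R]_N * 'rV[R]_N)) : C `<=` D ->
  \esum_(p in C) vol p <= \esum_(p in D) vol p.
Proof.
move=> CD; rewrite [leLHS]esum_mkcond [leRHS]esum_mkcond.
apply: le_esum => p _; case: ifPn => pC; last by case: ifPn => // _; exact: vol_ge0.
by rewrite (mem_set (CD _ (set_mem pC))).
Qed.

Lemma lebesgue_outer_sigma_subadditive :
  sigma_subadditive (@lebesgue_outer R N).
Proof.
move=> A; have [[i ioo]|] := pselect (exists i, lebesgue_outer (A i) = +oo).
  rewrite (eseries_pinfty _ _ ioo) ?leey// => n _.
  by rewrite -ltNye (lt_le_trans _ (lebesgue_outer_ge0 _)).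
rewrite -forallNE => Aoo.
apply/lee_addgt0Pr => _/posnumP[e].
rewrite (le_trans _ (epsilon_trick _ _ _))//; last first.
  by move=> n; exact: lebesgue_outer_ge0.
pose P n C := box_cover (A n) C /\
  \esum_(p in C) vol p <= lebesgue_outer (A n) + (e%:num / (2 ^ n.+1)%:R)%:E.
have [G PG] : {G & forall n, P n (G n)}.
  apply: (@choice _ _ P) => n; rewrite /P.
  have en1 : (0 < e%:num / (2 ^ n.+1)%:R :> R)%R by [].
  have fA : lebesgue_outer (A n) \is a fin_num.
    by rewrite ge0_fin_numE ?lebesgue_outer_ge0// ltey; exact/eqP/Aoo.
  have [_ [C CA <-] /ltW CA'] := lb_ereal_inf_adherent en1 fA.
  by exists C.
apply: (@le_trans _ _ (\esum_(p in \bigcup_n G n) vol p)).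
  apply: ereal_inf_lbound; exists (\bigcup_n G n) => //; split.
    by apply: bigcup_countable => // n _; exact: (PG n).1.1.
  move=> x [n _ /(PG n).1.2[p Gp px]].
  by exists p => //; exists n.
rewrite seqDU_bigcup_eq esum_bigcupT; [|exact: trivIset_seqDU|exact: vol_ge0].
rewrite -nneseries_esumT; last first.
  by move=> n; apply: esum_ge0 => p _; exact: vol_ge0.
apply: lee_nneseries => [n _ _|n _].
  by apply: esum_ge0 => p _; exact: vol_ge0.
by apply: le_trans (PG n).2; apply: le_esum_set; exact: subset_seqDU.
Qed.

HB.instance Definition _ := isOuterMeasure.Build R 'rV[R]_N
  (@lebesgue_outer R N) lebesgue_outer0 lebesgue_outer_ge0
  le_lebesgue_outer lebesgue_outer_sigma_subadditive.

End lebesgue_outer_measure.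

(* The measurable sets of [Rn R N] are the Caratheodory-measurable ones, i.e.,
   all Lebesgue measurable sets and not only the Borel ones. *)
Notation Rn R N := (caratheodory_type (@lebesgue_outer R N)).

Section lebesgue_Rn.
Context (R : realType) (N : nat).

Definition lebesgue_Rn : set (Rn R N) -> \bar R := @lebesgue_outer R N.

Let lebesgue_Rn0 : lebesgue_Rn set0 = 0%E.
Proof. exact: lebesgue_outer0. Qed.

Let lebesgue_Rn_ge0 (A : set (Rn R N)) : (0 <= lebesgue_Rn A)%E.
Proof. exact: lebesgue_outer_ge0. Qed.

Let lebesgue_Rn_semi_sigma_additive : semi_sigma_additive lebesgue_Rn.
Proof.
move=> F mF tF mUF.
exact: (@caratheodory_measure_sigma_additive _ _ (@lebesgue_outer R N)).
Qed.

HB.instance Definition _ := isMeasure.Build _ _ _ lebesgue_Rn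
  lebesgue_Rn0 lebesgue_Rn_ge0 lebesgue_Rn_semi_sigma_additive.

End lebesgue_Rn.

Definition partial {R : realType} {N : nat} (i : 'I_N) (f : 'rV[R]_N -> R) :
    'rV[R]_N -> R :=
  fun x => 'D_(delta_mx ord0 i) f x.

Definition smooth {R : realType} {N : nat} (f : 'rV[R]_N -> R) : Prop :=
  forall s : seq 'I_N, let g := foldr partial f s in
    continuous g /\ forall i x, derivable g x (delta_mx ord0 i).

Definition divergence {R : realType} {N : nat} (v : 'rV[R]_N -> 'rV[R]_N)
    (x : 'rV[R]_N) : R :=
  \sum_(i < N) partial i (fun y => v y ord0 i) x.

Definition test_field {R : realType} {N : nat} (v : 'rV[R]_N -> 'rV[R]_N) :
    Prop :=
  (forall i, smooth (fun x => v x ord0 i)) /\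
  compact (closure [set x | v x != 0]).

(* Only applied to continuous fields, for which the supremum and the essential
   supremum coincide. *)
Definition sup_norm {R : realType} {N : nat} (v : 'rV[R]_N -> 'rV[R]_N) :
    \bar R :=
  ereal_sup (range (fun x => (enorm (v x))%:E)).

Definition total_variation {R : realType} {N : nat} (u : 'rV[R]_N -> R) :
    \bar R :=
  ereal_sup [set (\int[@lebesgue_Rn R N]_x ((u x * divergence v x)%R)%:E)%E |
             v in [set v | test_field v /\ sup_norm v = 1%:E]].

Definition vanishes_at_infinity {R : realType} {N : nat} (u : 'rV[R]_N -> R) :
    Prop :=
  forall eps : R, 0 < eps ->
    (@lebesgue_Rn R N [set x | (eps < `|u x|)%R] < +oo)%E.

(* Without local integrability the integrals of u * div v are undefined. *)
Definition loc_integrable {R : realType} {N : nat} (u : 'rV[R]_N -> R) : Prop :=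
  forall K : set 'rV[R]_N, compact K ->
    (\int[@lebesgue_Rn R N]_(x in K) (`|u x|%R)%:E < +oo)%E.

Definition BVdot (R : realType) (N : nat) : set ('rV[R]_N -> R) :=
  [set u | [/\ measurable_fun [set: Rn R N] (u : Rn R N -> R),
               vanishes_at_infinity u, loc_integrable u &
               (total_variation u < +oo)%E]].

Arguments BVdot : clear implicits.

Definition BVdot_sphere (R : realType) (N : nat) : set ('rV[R]_N -> R) :=
  [set u | BVdot R N u /\ total_variation u = 1%:E].

Arguments BVdot_sphere : clear implicits.

(* Extended-real valued: when F 0 < 0 it is -oo on every function vanishing at
   infinity for which the positive part of F \o u is integrable. *)
Definition functional {R : realType} {N : nat} (F : R -> R)
    (u : 'rV[R]_N -> R) : \bar R :=
  (\int[@lebesgue_Rn R N]_x (F (u x))%:E)%E.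

Definition is_maximizer {R : realType} {N : nat} (F : R -> R)
    (u : 'rV[R]_N -> R) : Prop :=
  BVdot_sphere R N u /\
  functional F u = ereal_sup [set functional F v | v in BVdot_sphere R N].

(* 1^* = N / (N - 1), the Sobolev conjugate of 1. *)
Definition crit_exp (R : realType) (N : nat) : R := N%:R / (N%:R - 1).

(* w_r = r^(1-N) a \chi_(B_r), with B_r centred at x0. *)
Definition bubble {R : realType} {N : nat} (a : R) (x0 : 'rV[R]_N) (r : R) :
    'rV[R]_N -> R :=
  fun x => r `^ (1 - N%:R) * a * \1_(eball x0 r) x.

(* Main.v *)
Require Import Defs.
From mathcomp Require Import all_boot all_order all_algebra.
From mathcomp Require Import all_classical all_reals all_analysis.
From mathcomp Require Import measurable_realfun lra.
Set Implicit Arguments.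
Unset Strict Implicit.
Unset Printing Implicit Defensive.
Import Order.TTheory GRing.Theory Num.Theory.
Import numFieldNormedType.Exports.
Local Open Scope classical_set_scope.
Local Open Scope ring_scope.

(** Write [G s = m |s|^p] with [p = N / (N - 1)].  By the choice of [m] we have
    [F <= G], with equality at [t].  The integral of [G o u] is [m] times the
    quantity maximized by [w = a 1_B], so it suffices to find a maximizer of
    [|.|^p] on the sphere whose only nonzero value is a contact point of [F]
    and [G] ([is_maximizer_contact]).  The rescaled indicators
    [R^(1-N) a 1_(B_R)] are all maximizers, because the map
    [u |-> r^(N-1) u (x0 + r (x - x1))] preserves both the total variation and
    the integral of [|u|^p]; the choice [R = (a / t)^(1 / (N - 1))] gives them
    the height [t], and a global sign handles negative [t].

    Since [F s <= m |s|^p] near [0], continuity gives [F 0 <= 0].  If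
    [F 0 = 0], then [F o u = G o u] for the rescaled indicator [u] and the
    maximality for [F] follows by integrating [F o v <= G o v].  If [F 0 < 0],
    then [F o v] is bounded above by a negative constant on a set of infinite
    measure while its positive part is integrable, so the functional is [-oo]
    on the whole sphere ([functionalNy]) and every point of the sphere is a
    maximizer.

    Scale invariance rests on [lebesgue_outer_dilation], read off from covers
    by boxes, which also makes dilations measurable.  It yields the change of
    variables [integral_dilation] for arbitrary integrands, because simple
    functions are transported to simple functions.  Dilating a test field
    [v] to [s v (x0 + r (x - x1))] with [s = 1] or [s = -1] keeps its sup norm
    and multiplies its divergence by [s r] ([divergence_dilation]), whence the
    invariance of the total variation ([total_variation_rescale]).  The same
    scaling law shows that the measure of the whole space is [0] or [+oo]; the
    former would make every total variation vanish ([lebesgue_Rn_setT]). *)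

(** * Integrals of arbitrary functions *)

Section integral_without_measurability.
Local Open Scope ereal_scope.
Context d (T : measurableType d) (R : realType).
Variable mu : {measure set T -> \bar R}.
Implicit Types (f g : T -> \bar R).

(** The integral of a nonnegative function is a supremum over the simple functions
    below it, and that set grows with the function. *)
Lemma ge0_le_integral_nonmeas f g : (forall x, 0 <= f x) ->
  (forall x, f x <= g x) -> \int[mu]_x f x <= \int[mu]_x g x.
Proof.
move=> f0 fg; rewrite !ge0_integralTE//; last first.
  by move=> x; exact: le_trans (fg x).
by apply: le_ereal_sup => _ [h hf <-]; exists h => // x; exact: le_trans (fg x).
Qed.

Lemma le_integral_nonmeas f g : (forall x, f x <= g x) ->
  \int[mu]_x f x <= \int[mu]_x g x.
Proof.
move=> fg; have {}fg : {in [set: T], forall x, f x <= g x} by move=> x _.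
rewrite integralE [leRHS]integralE; apply: leeB.
  by apply: ge0_le_integral_nonmeas => // x; apply: (funepos_le fg); rewrite inE.
by apply: ge0_le_integral_nonmeas => // x; apply: (funeneg_le fg); rewrite inE.
Qed.

Section change_of_variables.

Import HBNNSimple.

(* A simple function below [k f o phi] is [k h' o phi] with [h' <= f] simple, and
   the scaling law for [h'] is the usual image-measure formula. *)
Let le_integral_comp (phi psi : T -> T) (c k : R) f : (0 < c)%R ->
  measurable_fun setT phi -> measurable_fun setT psi ->
  cancel phi psi -> cancel psi phi ->
  (forall A, measurable A -> mu (phi @^-1` A) = c%:E * mu A) ->
  (0 < k)%R -> (forall x, 0 <= f x) ->
  \int[mu]_x (k%:E * f (phi x)) <= (k * c)%:E * \int[mu]_x f x.
Proof.
move=> c0 mphi mpsi phiK psiK mu_phi k0 f0; rewrite ge0_integralTE; last first.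
  by move=> x; rewrite mule_ge0// lee_fin ltW.
apply: ge_ereal_sup => _ [h /= hf <-]; rewrite -integralT_nnsfun.
pose h' : T -> \bar R := fun y => (k^-1 * h (psi y))%:E.
have h'0 y : 0 <= h' y by rewrite lee_fin mulr_ge0// invr_ge0 ltW.
have mh' : measurable_fun setT h'.
  apply/measurable_EFinP/measurable_funM => //.
  exact: measurableT_comp.
have -> : \int[mu]_x (h x)%:E = \int[mu]_x (k%:E * h' (phi x)).
  by apply: eq_integral => x _; rewrite /h' phiK -EFinM mulVKf// gt_eqF.
have hphi : \int[mu]_x h' (phi x) = c%:E * \int[mu]_x h' x.
  have -> : \int[mu]_x h' (phi x) = \int[pushforward mu phi]_x h' x.
    by rewrite ge0_integral_pushforward.
  have c0' : (0 <= c)%R := ltW c0.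
  rewrite [LHS](eq_measure_integral (mscale (NngNum c0') mu)).
    by rewrite ge0_integral_mscale.
  by move=> A mA _; rewrite [LHS]mu_phi.
rewrite ge0_integralZl//; last 2 first.
  exact: measurableT_comp.
  by rewrite lee_fin ltW.
rewrite hphi muleA -EFinM lee_pmul2l ?lte_fin ?mulr_gt0//.
apply: ge0_le_integral_nonmeas => // y.
by rewrite /h' EFinM lee_pdivrMl//; have := hf (psi y); rewrite psiK.
Qed.

Variables (phi psi : T -> T) (c : R).
Hypotheses (c0 : (0 < c)%R) (mphi : measurable_fun setT phi)
  (mpsi : measurable_fun setT psi) (phiK : cancel phi psi)
  (psiK : cancel psi phi).
Hypothesis mu_phi : forall A, measurable A -> mu (phi @^-1` A) = c%:E * mu A.

Let mu_psi A : measurable A -> mu (psi @^-1` A) = c^-1%:E * mu A.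
Proof.
move=> mA; have mpA : measurable (psi @^-1` A).
  by rewrite -[X in measurable X]setTI; exact: mpsi.
have := mu_phi mpA.
have -> : phi @^-1` (psi @^-1` A) = A by apply/seteqP; split => x /=; rewrite phiK.
by move=> ->; rewrite muleA -EFinM mulVf ?mul1e// gt_eqF.
Qed.

Let ge0_integral_comp f (k : R) : (0 < k)%R -> (forall x, 0 <= f x) ->
  \int[mu]_x (k%:E * f (phi x)) = (k * c)%:E * \int[mu]_x f x.
Proof.
move=> k0 f0; apply/eqP; rewrite eq_le (@le_integral_comp phi psi c)//=.
have kc0 : (0 < k * c)%R by exact: mulr_gt0.
rewrite -lee_pdivlMl//.
have -> : \int[mu]_x f x = \int[mu]_x (k^-1%:E * (k%:E * f (phi (psi x)))).
  by apply: eq_integral => x _; rewrite psiK muleA -EFinM mulVf ?mul1e// gt_eqF.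
rewrite invfM (@le_integral_comp psi phi c^-1 k^-1 (fun x => k%:E * f (phi x)))//.
- by rewrite invr_gt0.
- by rewrite invr_gt0.
- by move=> x; rewrite mule_ge0// lee_fin ltW.
Qed.

(** Change of variables for a bimeasurable bijection that multiplies the measure
    by [c].  The integral of [f] is the difference of two suprema over the simple
    functions below [f^+] and below [f^-], and composition with [phi] transports
    these simple functions bijectively. *)
Lemma integral_comp_scaling f (k : R) : (0 < k)%R ->
  \int[mu]_x (k%:E * f (phi x)) = (k * c)%:E * \int[mu]_x f x.
Proof.
move=> k0; have kc0 : (0 < k * c)%R by exact: mulr_gt0.
rewrite integralE (ge0_funeposM (f \o phi) (ltW k0)).
rewrite (ge0_funenegM (f \o phi) (ltW k0)) funepos_comp funeneg_comp /=.
rewrite (@ge0_integral_comp f^\+)// (@ge0_integral_comp f^\-)//.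
rewrite [in RHS]integralE.
have : 0 <= \int[mu]_x f^\+ x by exact: integral_ge0.
have : 0 <= \int[mu]_x f^\- x by exact: integral_ge0.
case: (\int[mu]_x f^\+ x) => [p| |]//; case: (\int[mu]_x f^\- x) => [q| |]// _ _.
  by rewrite -EFinM -EFinM -EFinB -EFinB -EFinM mulrBr.
all: by rewrite gt0_muley//= ?gt0_muley// ?gt0_muleNy.
Qed.

End change_of_variables.

Lemma integral_pZl_nonmeas f (k : R) : (0 < k)%R ->
  \int[mu]_x (k%:E * f x) = k%:E * \int[mu]_x f x.
Proof.
move=> k0; have := @integral_comp_scaling id id 1 ltr01 (@measurable_id _ _ _)
  (@measurable_id _ _ _) (fun=> erefl) (fun=> erefl) _ f k k0.
by rewrite mulr1; apply => A _; rewrite preimage_id mul1e.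
Qed.

End integral_without_measurability.

Lemma esum_pZl (R : realType) (T : choiceType) (I : set T) (a : T -> \bar R)
    (k : R) : 0 < k -> (forall i, (0 <= a i)%E) ->
  (\esum_(i in I) (k%:E * a i) = k%:E * \esum_(i in I) a i)%E.
Proof.
move=> k0 a0; rewrite /esum -ereal_sup_pZl// image_comp; congr ereal_sup.
by apply: eq_imagel => X _ /=; rewrite ge0_mule_fsumr.
Qed.

(** * Dilations and Lebesgue measure *)

(** The similarity of ratio [r] that sends [p] to [q]; with this choice of
    parameters its inverse is [dilation r^-1 q p]. *)
Definition dilation {R : realType} {N : nat} (r : R) (p q y : 'rV[R]_N) :
    'rV[R]_N :=
  q + r *: (y - p).

Section dilation.
Context {R : realType} {N : nat}.
Implicit Types (r : R) (p q x y : 'rV[R]_N) (A : set 'rV[R]_N).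

Lemma dilationK r p q : r != 0 ->
  cancel (dilation r p q) (dilation r^-1 q p).
Proof.
move=> r0 y; rewrite /dilation [q + _]addrC addrK scalerA mulVf// scale1r.
by rewrite addrC subrK.
Qed.

Lemma dilationVK r p q : r != 0 ->
  cancel (dilation r^-1 q p) (dilation r p q).
Proof.
by move=> r0; rewrite -[X in dilation X p q]invrK; apply: dilationK; rewrite invr_eq0.
Qed.

Lemma dilationE r p q x i :
  dilation r p q x ord0 i = q ord0 i + r * (x ord0 i - p ord0 i).
Proof. by rewrite /dilation !mxE. Qed.

Lemma enorm_dilation r p q x : 0 < r ->
  enorm (dilation r p q x - q) = r * enorm (x - p).
Proof.
move=> r0; rewrite /enorm.
under eq_bigr do rewrite /dilation !mxE [q _ _ + _]addrC addrK exprMn.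
rewrite -mulr_sumr sqrtrM ?sqr_ge0// sqrtr_sqr gtr0_norm//.
by congr (_ * Num.sqrt _); apply: eq_bigr => i _; rewrite !mxE.
Qed.

Lemma continuous_dilation r p q : continuous (dilation r p q).
Proof.
move=> x; have xp : {for x, continuous (fun y : 'rV[R]_N => y - p)}.
  by apply: (@cvgD R _ _ (nbhs x) _ id (cst (- p)) x (- p));
    [exact: cvg_id|exact: cvg_cst].
have rxp := @continuousZl_tmp R _ _ _ r x xp.
by apply: (@cvgD R _ _ (nbhs x) _ (cst q) (r \*: (fun y : 'rV[R]_N => y - p)));
  [exact: cvg_cst|exact: rxp].
Qed.

(* The inverse dilation maps a cover of [A] by boxes to a cover of the preimage,
   and multiplies each volume by [r ^- N]. *)
Let le_lebesgue_outer_dilation r p q A : 0 < r ->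
  (lebesgue_outer (dilation r p q @^-1` A) <= (r ^- N)%:E * lebesgue_outer A)%E.
Proof.
move=> r0; have rn0 : r != 0 by rewrite gt_eqF.
have rN0 : 0 < r ^- N by rewrite invr_gt0 exprn_gt0.
rewrite -lee_pdivrMl// [leRHS]/lebesgue_outer.
apply: le_ereal_inf_tmp => _ [C [cC AC] <-]; rewrite lee_pdivrMl//.
pose e (b : 'rV[R]_N * 'rV[R]_N) :=
  (dilation r^-1 q p b.1, dilation r^-1 q p b.2).
have einj : injective e.
  move=> [b1 b2] [c1 c2] [] /(can_inj (dilationVK _ _ rn0)) ->.
  by move=> /(can_inj (dilationVK _ _ rn0)) ->.
have vol_e b : box_volume (e b) = r ^- N * box_volume b.
  rewrite /box_volume /= -exprVn -[X in _ ^+ X]card_ord -prodr_const -big_split /=.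
  apply: eq_bigr => i _; rewrite !dilationE opprD addrACA subrr add0r -mulrBr.
  rewrite maxr_pMr ?mulr0 ?invr_ge0 ?ltW//; congr (Num.max _ (_ * _)).
  by rewrite opprB addrA subrK.
have -> : ((r ^- N)%:E * (\esum_(b in C) (box_volume b)%:E) =
    \esum_(b in e @` C) (box_volume b)%:E)%E.
  rewrite esum_image; last by move=> ? ? _ _; exact: einj.
  rewrite -esum_pZl//; last by move=> b; rewrite lee_fin box_volume_ge0.
  by apply: eq_esum => b _; rewrite vol_e EFinM.
apply: ereal_inf_lbound; exists (e @` C) => //; split.
  exact: (card_le_trans (card_image_le _ _) cC).
move=> x /AC[b Cb xb]; exists (e b); first by exists b.
move=> i; have /= := xb i; rewrite !dilationE => /andP[b1 b2].
apply/andP; split.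
  by rewrite -ltrBrDl ltr_pdivrMl// ltrBlDl.
by rewrite -lerBlDl ler_pdivlMl// lerBrDl.
Qed.

(** The reverse inequality is the direct one for the inverse dilation. *)
Lemma lebesgue_outer_dilation r p q A : 0 < r ->
  (lebesgue_outer (dilation r p q @^-1` A) = (r ^- N)%:E * lebesgue_outer A)%E.
Proof.
move=> r0; have rn0 : r != 0 by rewrite gt_eqF.
have rN0 : 0 < r ^- N by rewrite invr_gt0 exprn_gt0.
apply/eqP; rewrite eq_le le_lebesgue_outer_dilation//=.
rewrite -lee_pdivlMl// invrK.
have := @le_lebesgue_outer_dilation r^-1 q p (dilation r p q @^-1` A).
rewrite invr_gt0 exprVn invrK => /(_ r0).
by rewrite -comp_preimage (_ : _ \o _ = id)// funeqE => x /=; rewrite dilationVK.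
Qed.

(** Caratheodory's criterion for the preimage of [A] against a set [X] is the
    criterion for [A] against the image of [X], up to the factor [r ^- N]. *)
Lemma measurable_dilation r p q : 0 < r ->
  measurable_fun [set: Rn R N] (dilation r p q : Rn R N -> Rn R N).
Proof.
move=> r0 _ A mA; rewrite setTI.
change (caratheodory_measurable (@lebesgue_outer R N) (dilation r p q @^-1` A)).
change (caratheodory_measurable (@lebesgue_outer R N) A) in mA.
move=> X; have rn0 : r != 0 by rewrite gt_eqF.
have pre B : dilation r p q @^-1` (dilation r^-1 q p @^-1` B) = B.
  by rewrite -comp_preimage (_ : _ \o _ = id)// funeqE => x /=; rewrite dilationK.
rewrite -[X]pre preimage_setC -!preimage_setI !(lebesgue_outer_dilation p q _ r0).
rewrite (mA (dilation r^-1 q p @^-1` X)) ge0_muleDr//; exact: lebesgue_outer_ge0.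
Qed.

Lemma integral_dilation r p q (k : R) (f : 'rV[R]_N -> \bar R) :
  0 < r -> 0 < k ->
  (\int[@lebesgue_Rn R N]_x (k%:E * f (dilation r p q x)) =
   (k * r ^- N)%:E * \int[@lebesgue_Rn R N]_x f x)%E.
Proof.
move=> r0 k0; have rn0 : r != 0 by rewrite gt_eqF.
apply: (@integral_comp_scaling _ (Rn R N) R (@lebesgue_Rn R N) (dilation r p q)
  (dilation r^-1 q p)) => //.
- by rewrite invr_gt0 exprn_gt0.
- exact: measurable_dilation.
- by apply: measurable_dilation; rewrite invr_gt0.
- exact: dilationK.
- exact: dilationVK.
- by move=> A _; exact: lebesgue_outer_dilation.
Qed.

Lemma integral_dilation_jacobian r p q (f : 'rV[R]_N -> \bar R) : 0 < r ->
  (\int[@lebesgue_Rn R N]_x ((r ^+ N)%:E * f (dilation r p q x)) =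
   \int[@lebesgue_Rn R N]_x f x)%E.
Proof.
move=> r0; have rN0 : 0 < r ^+ N by exact: exprn_gt0.
by rewrite integral_dilation// divff ?mul1e// gt_eqF.
Qed.

End dilation.

(** * Dilations of test fields *)

Section calculus.
Context {R : realType} {N : nat}.
Implicit Types (r c : R) (p q x : 'rV[R]_N) (f : 'rV[R]_N -> R).

Lemma cvg_dnbhs0_mull r : r != 0 -> (fun h : R => r * h) h @[h --> 0^'] --> 0^'.
Proof.
move=> r0 U U0; have U0' : nbhs (0 : R) [set h : R | h != 0 -> U h] := U0.
have r_cont : (fun h : R => r * h) h @[h --> (0 : R)] --> (0 : R).
  by rewrite -[X in _ --> X](mulr0 r); exact: mulrl_continuous.
change (nbhs (0 : R) [set h : R | h != 0 -> U (r * h)]).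
have : \forall h \near (0 : R), r * h != 0 -> U (r * h) := r_cont _ U0'.
by apply: filterS => h Uh h0; apply: Uh; rewrite mulf_neq0.
Qed.

(** The difference quotient of [f o dilation] with increment [h] is [r] times that
    of [f] with increment [r h], so directional derivability at the image point
    suffices. *)
Lemma is_derive_comp_dilation c r p q f x (v : 'rV[R]_N) : r != 0 ->
  derivable f (dilation r p q x) v ->
  is_derive x v (fun y => c * f (dilation r p q y))
    (c * r * 'D_v f (dilation r p q x)).
Proof.
move=> r0 df; set L := 'D_v f _.
suff lim : (fun h => h^-1 *: (((fun y => c * f (dilation r p q y)) \o shift x)
    (h *: v) - c * f (dilation r p q x))) h @[h --> 0^'] --> c * r * L.
  by apply: DeriveDef; [apply/cvg_ex; exists (c * r * L)|exact: cvg_lim].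
have := cvg_comp _ _ (cvg_dnbhs0_mull r0) df.
rewrite -/(derive _ _ _) -/L => /(@cvgZl_tmp _ R^o _ _ _ (c * r)).
apply: cvg_trans; apply: near_eq_cvg; apply: nearW => h.
rewrite /= /shift /=.
have -> : dilation r p q (h *: v + x) = (r * h) *: v + dilation r p q x.
  by rewrite /dilation -addrA scalerDr scalerA addrCA.
rewrite /GRing.scale /= invfM -mulrBr !mulrA; congr (_ * _).
by rewrite mulfK// mulrC.
Qed.

(** Each partial derivative contributes one factor [r]; the constant [c] lets the
    same formula cover changes of sign. *)
Lemma foldr_partial_dilation c r p q f (s : seq 'I_N) : r != 0 -> smooth f ->
  foldr partial (fun x => c * f (dilation r p q x)) s =
  (fun x => c * r ^+ size s * foldr partial f s (dilation r p q x)).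
Proof.
move=> r0 sf; elim: s => [|i s IHs] /=; first by rewrite expr0 mulr1.
rewrite IHs; apply/funext => x; rewrite /partial.
have dfs := (sf s).2 i (dilation r p q x).
have [_ ->] := is_derive_comp_dilation (c * r ^+ size s) r0 dfs.
by rewrite -(mulrA c) -exprSr.
Qed.

Lemma smooth_dilation c r p q f : r != 0 -> smooth f ->
  smooth (fun x => c * f (dilation r p q x)).
Proof.
move=> r0 sf s; rewrite /= foldr_partial_dilation//; split=> [x|i x].
  apply: (@continuousM _ _ (cst (c * r ^+ size s))
    (foldr partial f s \o dilation r p q)); first exact: cst_continuous.
  by apply: continuous_comp; [exact: continuous_dilation|exact: (sf s).1].
by have [] := is_derive_comp_dilation (c * r ^+ size s) r0
  ((sf s).2 i (dilation r p q x)).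
Qed.

End calculus.

Section fields.
Context {R : realType} {N : nat}.
Variables (s r : R) (p q : 'rV[R]_N).
Hypotheses (s2 : s ^+ 2 = 1) (r0 : r != 0).
Implicit Types v : 'rV[R]_N -> 'rV[R]_N.

Let s0 : s != 0. Proof. by rewrite -sqrf_eq0 s2 oner_eq0. Qed.

Let pullback v := fun x => s *: v (dilation r p q x).

Lemma divergence_dilation v x : (forall i, smooth (fun x => v x ord0 i)) ->
  divergence (pullback v) x = s * r * divergence v (dilation r p q x).
Proof.
move=> sv; rewrite /divergence mulr_sumr; apply: eq_bigr => i _.
rewrite /partial (_ : (fun y => _) =
  (fun y => s * (v (dilation r p q y)) ord0 i)).
  by have [_ ->] := is_derive_comp_dilation s r0 ((sv i [::]).2 i (dilation r p q x)).
by apply/funext => y; rewrite /pullback mxE.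
Qed.

(** The support of the pullback lies in the image of the support of [v] under the
    inverse dilation, which is continuous. *)
Lemma test_field_dilation v : test_field v -> test_field (pullback v).
Proof.
move=> [sv cv]; split.
  move=> i; rewrite (_ : (fun y => _) =
    (fun y => s * (v (dilation r p q y)) ord0 i)).
    exact: (smooth_dilation s p q r0 (sv i)).
  by apply/funext => y; rewrite /pullback mxE.
have suppE : [set x | pullback v x != 0] = dilation r p q @^-1` [set x | v x != 0].
  by apply/seteqP; split => x /=; rewrite /pullback scaler_eq0 (negbTE s0).
rewrite suppE.
have preE (A : set 'rV[R]_N) : dilation r p q @^-1` A = dilation r^-1 q p @` A.
  apply/seteqP; split => [x Ax|_ [y Ay <-]] /=; last by rewrite dilationVK.
  by exists (dilation r p q x) => //; rewrite dilationK.
have closed_supp : closed (dilation r p q @^-1` closure [set x | v x != 0]).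
  apply: preimage_closed; last exact: closed_closure.
  by move=> x _; exact: continuous_dilation.
apply: (@subclosed_compact _ _ (dilation r p q @^-1` closure [set x | v x != 0])).
- exact: closed_closure.
- rewrite preE; apply: continuous_compact => //.
  exact/continuous_subspaceT/continuous_dilation.
- rewrite [X in _ `<=` X](closure_id _).1; last exact: closed_supp.
  apply: closure_subset => x vx; rewrite /=; apply: subset_closure; exact: vx.
Qed.

End fields.

Lemma enormZ_sign {R : realType} {N : nat} (s : R) (x : 'rV[R]_N) :
  s ^+ 2 = 1 -> enorm (s *: x) = enorm x.
Proof.
by move=> s2; rewrite /enorm; under eq_bigr do rewrite mxE exprMn s2 mul1r.
Qed.

Lemma sup_norm_dilation {R : realType} {N : nat} (s r : R) (p q : 'rV[R]_N)
    (v : 'rV[R]_N -> 'rV[R]_N) : s ^+ 2 = 1 -> r != 0 ->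
  sup_norm (fun x => s *: v (dilation r p q x)) = sup_norm v.
Proof.
move=> s2 r0; congr ereal_sup; apply/seteqP; split => [_ [x _ <-]|_ [x _ <-]].
  by exists (dilation r p q x) => //; rewrite enormZ_sign.
by exists (dilation r^-1 q p x) => //; rewrite enormZ_sign// dilationVK.
Qed.

(** * Scale invariance of the total variation *)

(** The factor [r ^+ N.-1] is the one that preserves the total variation: the
    Jacobian costs [r ^- N] and the divergence gives back one [r]. *)
Definition rescale {R : realType} {N : nat} (s r : R) (p q : 'rV[R]_N)
    (u : 'rV[R]_N -> R) : 'rV[R]_N -> R :=
  fun x => s * r ^+ N.-1 * u (dilation r p q x).

Section rescale.
Context {R : realType} {N : nat}.
Hypothesis N0 : (0 < N)%N.
Implicit Types (s r : R) (p q : 'rV[R]_N) (u : 'rV[R]_N -> R).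

Lemma rescaleK s r p q u : s ^+ 2 = 1 -> r != 0 ->
  rescale s r^-1 q p (rescale s r p q u) = u.
Proof.
move=> s2 r0; apply/funext => x; rewrite /rescale dilationVK// mulrA.
by rewrite mulrACA -expr2 s2 mul1r exprVn mulVf ?mul1r// expf_neq0.
Qed.

Lemma norm_rescale s r p q u x : s ^+ 2 = 1 -> 0 < r ->
  `|rescale s r p q u x| = r ^+ N.-1 * `|u (dilation r p q x)|.
Proof.
move=> s2 r0; rewrite /rescale !normrM [X in _ * X * _](ger0_norm (exprn_ge0 _ (ltW r0))).
suff -> : `|s| = 1 by rewrite mul1r.
by apply/eqP; rewrite -sqrp_eq1// real_normK ?num_real// s2.
Qed.

(* Testing [rescale s r p q u] with [v] is testing [u] with the pullback of [s v]
   under the inverse dilation. *)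
Let le_total_variation_rescale s r p q u : s ^+ 2 = 1 -> 0 < r ->
  (Defs.total_variation (rescale s r p q u) <= Defs.total_variation u)%E.
Proof.
move=> s2 r0; have rn0 : r != 0 by rewrite gt_eqF.
apply: le_ereal_sup => _ [v [tv v1] <-].
exists (fun x => s *: v (dilation r^-1 q p x)).
  split; first by apply: test_field_dilation => //; rewrite invr_eq0.
  by rewrite sup_norm_dilation// invr_eq0.
rewrite -(integral_dilation_jacobian p q _ r0); apply: eq_integral => x _.
rewrite divergence_dilation ?invr_eq0//; last exact: tv.1.
rewrite dilationK// -EFinM /rescale -[in r ^+ N](prednK N0) exprSr; congr (_%:E).
set D := divergence v x; set U := u _.
rewrite [s / r]mulrC -!mulrA (mulrCA U r^-1) (mulVKf rn0).
by rewrite (mulrCA U s) (mulrCA (r ^+ N.-1) s).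
Qed.

Lemma total_variation_rescale s r p q u : s ^+ 2 = 1 -> 0 < r ->
  Defs.total_variation (rescale s r p q u) = Defs.total_variation u.
Proof.
move=> s2 r0; have rn0 : r != 0 by rewrite gt_eqF.
apply/eqP; rewrite eq_le le_total_variation_rescale//=.
rewrite -[in leLHS](rescaleK p q u s2 rn0).
by apply: le_total_variation_rescale; rewrite ?invr_gt0.
Qed.

Lemma BVdot_sphere_rescale s r p q u : s ^+ 2 = 1 -> 0 < r ->
  BVdot_sphere R N u -> BVdot_sphere R N (rescale s r p q u).
Proof.
move=> s2 r0 [[mu vu lu _] TVu]; have rn0 : r != 0 by rewrite gt_eqF.
have rN0 : 0 < r ^+ N.-1 by exact: exprn_gt0.
have TV1 : Defs.total_variation (rescale s r p q u) = 1%:E.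
  by rewrite total_variation_rescale.
split=> //; split; last by rewrite TV1 ltry.
- apply: measurable_funM => //.
  exact: (measurableT_comp mu (measurable_dilation p q r0)).
- move=> e e0; have := vu (e / r ^+ N.-1); rewrite divr_gt0// => /(_ isT) fin.
  rewrite (_ : [set x | _] =
    dilation r p q @^-1` [set x | e / r ^+ N.-1 < `|u x|]); last first.
    by apply/seteqP; split => x /=; rewrite norm_rescale// ltr_pdivrMr// mulrC.
  rewrite [ltLHS](lebesgue_outer_dilation p q _ r0).
  by rewrite lte_mul_pinfty// lee_fin invr_ge0 exprn_ge0// ltW.
- move=> K cK; have cK' : compact (dilation r p q @` K).
    by apply: continuous_compact => //; exact/continuous_subspaceT/continuous_dilation.
  have fin := lu _ cK'.
  rewrite integral_mkcond (_ : _ \_ _ = (fun x => (r ^+ N.-1)%:E *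
    ((fun y => `|u y|%:E) \_ (dilation r p q @` K)) (dilation r p q x))%E).
    rewrite integral_dilation// -integral_mkcond lte_mul_pinfty//.
    by rewrite lee_fin ltW// divr_gt0// exprn_gt0.
  apply/funext => x; rewrite !patchE norm_rescale//.
  have -> : (dilation r p q x \in dilation r p q @` K) = (x \in K).
    apply/idP/idP; rewrite !inE; last by exists x.
    by move=> [y Ky] /(can_inj (dilationK p q rn0)) <-.
  by case: ifP => _; rewrite ?mule0.
Qed.

End rescale.

Section critical_exponent.
Context {R : realType} {N : nat}.
Hypothesis N2 : (2 <= N)%N.
Let p : R := crit_exp R N.

Let natrN1 : N%:R - 1 = N.-1%:R :> R.
Proof. by rewrite -[X in _ - X]/(1%:R) -natrB ?subn1// ltnW. Qed.

Let N1_gt0 : 0 < N%:R - 1 :> R.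
Proof. by rewrite subr_gt0 ltr1n. Qed.

Lemma crit_exp_ge1 : 1 <= p.
Proof. by rewrite /p /crit_exp ler_pdivlMr// mul1r lerBlDr lerDl. Qed.

(** This identity singles out [N / (N - 1)] as the exponent for which the
    normalization of the total variation also preserves the integral. *)
Lemma powR_crit_exp (r : R) : 0 < r -> (r ^+ N.-1) `^ p = r ^+ N.
Proof.
move=> r0; rewrite -powR_mulrn ?ltW// -powRrM -natrN1 /p /crit_exp.
by rewrite mulrCA divff ?gt_eqF// mulr1 powR_mulrn// ltW.
Qed.

Lemma functional_pow_rescale (s r : R) (y z : 'rV[R]_N) (u : 'rV[R]_N -> R) :
  s ^+ 2 = 1 -> 0 < r ->
  functional (fun x => `|x| `^ p) (rescale s r y z u) =
  functional (fun x => `|x| `^ p) u.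
Proof.
move=> s2 r0; rewrite /functional -[RHS](integral_dilation_jacobian y z _ r0).
apply: eq_integral => x _; rewrite norm_rescale// -EFinM powRM//.
  by rewrite powR_crit_exp.
by rewrite exprn_ge0// ltW.
Qed.

End critical_exponent.

(** * Comparison of functionals *)

(** Dilating by [2] maps the space onto itself and multiplies its measure by
    [2 ^- N], so this measure is [0] or [+oo]; if it were [0], every integral,
    hence every total variation, would vanish. *)
Lemma lebesgue_Rn_setT {R : realType} {N : nat} (u : 'rV[R]_N -> R) :
  (0 < N)%N -> BVdot_sphere R N u -> @lebesgue_Rn R N setT = +oo%E.
Proof.
move=> N0 [_ TVu].
have : @lebesgue_Rn R N setT != 0%E.
  apply: contra_eqN TVu => /eqP T0.
  have null A : @lebesgue_Rn R N A = 0%E.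
    apply/eqP; rewrite eq_le [X in _ && X]lebesgue_outer_ge0 andbT -T0.
    exact: le_lebesgue_outer.
  rewrite lt_eqF// (@le_lt_trans _ _ 0%E)//.
  apply: ge_ereal_sup => _ [v _ <-].
  rewrite (eq_measure_integral (@mzero _ (Rn R N) R)); last by move=> A _ _; exact: null.
  by rewrite integral_measure_zero.
have := @lebesgue_outer_dilation R N 2 0 0 setT (ltr0Sn _ 1).
rewrite preimage_setT -/(@lebesgue_Rn R N).
have : (0 <= @lebesgue_Rn R N setT)%E by exact: lebesgue_outer_ge0.
case: (lebesgue_Rn setT) => [x| |]// x0 + x_neq0; rewrite -EFinM => -[] /eqP.
rewrite gt_eqF// gtr_pMl; last by rewrite lt_neqAle eq_sym x_neq0.
by rewrite invf_lt1 ?exprn_gt0// exprn_egt1 ?ltr1n// -lt0n.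
Qed.

Section comparison.
Context {R : realType} {N : nat}.
Variables (F G : R -> R).
Hypothesis G_ge0 : forall s, 0 <= G s.
Hypotheses (F_cont : continuous F) (FG : forall s, F s <= G s).

(** By continuity [F o v <= F 0 / 2 < 0] wherever [|v|] is small, and this set has
    infinite measure because [v] vanishes at infinity; meanwhile the positive part
    of [F o v] is at most [G o v], whose integral is finite. *)
Lemma functionalNy (v : 'rV[R]_N -> R) :
  @lebesgue_Rn R N setT = +oo%E -> BVdot R N v -> F 0 < 0 ->
  (functional G v < +oo)%E -> functional F v = -oo%E.
Proof.
move=> Too [mv vv _ _] F0 Gv.
rewrite /functional integralE.
have : (\int[@lebesgue_Rn R N]_x (fun x => (F (v x))%:E)^\+ x < +oo)%E.
  apply: le_lt_trans Gv; apply: ge0_le_integral_nonmeas => x //.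
  by rewrite funeposE /maxe; case: ifPn => _; rewrite lee_fin.
have : (0 <= \int[@lebesgue_Rn R N]_x (fun x => (F (v x))%:E)^\+ x)%E.
  exact: integral_ge0.
suff -> : (\int[@lebesgue_Rn R N]_x (fun x => (F (v x))%:E)^\- x = +oo)%E.
  by case: (\int[_]_x _)%E.
have k0 : 0 < - F 0 / 2 by rewrite divr_gt0// oppr_gt0.
have [d d0 Fd] : exists2 d, 0 < d & forall s, `|s| <= d -> F s <= F 0 / 2.
  have F_cont0 : {for 0, continuous F} by exact: F_cont.
  move/cvgrPdist_lt : F_cont0 => /(_ _ k0).
  move=> /nbhs_ballP[e /= e0 Fe]; exists (e / 2); first by rewrite divr_gt0.
  move=> s se; have := Fe s; rewrite /ball /= sub0r normrN.
  rewrite (le_lt_trans se) ?ltr_pdivrMr ?ltr_pMr ?ltr1n// => /(_ isT).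
  by rewrite distrC ltr_norml => /andP[_]; lra.
set A := [set x | `|v x| <= d].
have mA : measurable (A : set (Rn R N)).
  have -> : A = setT `&` v @^-1` `[- d, d].
    by apply/seteqP; split => x; rewrite /A /= in_itv/= -ler_norml => //; case.
  by apply: mv.
have Aoo : @lebesgue_Rn R N A = +oo%E.
  apply/eqP; rewrite eq_le leey/= leNgt; apply/negP => A_fin.
  have := lte_add_pinfty A_fin (vv d d0); apply/negP; rewrite -leNgt -Too.
  rewrite (_ : setT = A `|` [set x | d < `|v x|]).
    exact: (@outer_measureU2 _ _ (@lebesgue_outer R N)).
  by apply/seteqP; split => // x _; rewrite /A /=; case: leP; [left|right].
apply/eqP; rewrite eq_le leey/=.
have := integral_pZl_nonmeas (@lebesgue_Rn R N) (fun x => (\1_A x)%:E) k0.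
rewrite integral_indic// setIT [X in (_ * X)%E]Aoo gt0_muley ?lte_fin// => <-.
apply: ge0_le_integral_nonmeas => x; first by rewrite mule_ge0// lee_fin ltW.
rewrite indicE; case: (boolP (x \in A)) => xA; last by rewrite mule0.
rewrite mule1 funenegE le_max; apply/orP; left.
by rewrite lee_fin mulNr lerN2 Fd// ; move: xA; rewrite inE.
Qed.

(** If [F 0 = 0], the integrals of [F] and [G] agree at [u] and that of [G] dominates
    elsewhere.  If [F 0 < 0], the functional of [F] is [-oo] on the whole sphere. *)
Lemma is_maximizer_contact (u : 'rV[R]_N -> R) : (0 < N)%N -> G 0 = 0 ->
  is_maximizer G u -> (functional G u < +oo)%E ->
  (forall x, u x != 0 -> F (u x) = G (u x)) -> is_maximizer F u.
Proof.
move=> N0 G0 [Su Gu] Gu_fin FGu; split=> //; apply/eqP; rewrite eq_le.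
apply/andP; split; first by apply: ereal_sup_ubound; exists u.
apply: ge_ereal_sup => _ [v Sv <-].
have Gvu : (functional G v <= functional G u)%E.
  by rewrite Gu; apply: ereal_sup_ubound; exists v.
have [F0|F0] := ltP (F 0) 0.
  rewrite functionalNy ?leNye//.
  - exact: lebesgue_Rn_setT Su.
  - by case: Sv.
  - exact: le_lt_trans Gvu Gu_fin.
have {}F0 : F 0 = 0 by apply/eqP; rewrite eq_le F0 andbT; have := FG 0; rewrite G0.
have -> : functional F u = functional G u.
  apply: eq_integral => x _; have [->|/FGu ->//] := eqVneq (u x) 0.
  by rewrite F0 G0.
apply: le_trans Gvu; apply: le_integral_nonmeas => x; rewrite lee_fin.
exact: FG.
Qed.

End comparison.

Lemma is_maximizer_pZl {R : realType} {N : nat} (G : R -> R) (k : R)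
    (u : 'rV[R]_N -> R) : 0 < k -> is_maximizer G u ->
  is_maximizer (fun s => k * G s) u.
Proof.
have kE v : 0 < k -> functional (fun s => k * G s) v = (k%:E * functional G v)%E.
  by move=> k0; rewrite -integral_pZl_nonmeas.
move=> k0 [Su Gu]; split=> //; rewrite kE// Gu -ereal_sup_pZl// image_comp.
by congr ereal_sup; apply: eq_imagel => v _ /=; rewrite kE.
Qed.

(** * Rescaled indicators of balls *)

Lemma le0_of_le_mul_powR {R : realType} (F : R -> R) (k e : R) : 0 < k -> 1 <= e ->
  continuous F -> (forall s, s != 0 -> F s <= k * `|s| `^ e) -> F 0 <= 0.
Proof.
move=> k0 e1 F_cont FG; rewrite leNgt; apply/negP => F0.
have F02 : 0 < F 0 / 2 by rewrite divr_gt0.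
have F_cont0 : {for 0, continuous F} by exact: F_cont.
move/cvgrPdist_lt : F_cont0 => /(_ _ F02) /nbhs_ballP[d /= d0 Fd].
(* Small enough for continuity ([d / 2]), for [s ^ e <= s] ([1]), and for
   [k s <= F 0 / 2]. *)
pose s := Num.min (d / 2) (Num.min 1 (F 0 / 2 / k)).
have s0 : 0 < s by rewrite !lt_min ltr01 !divr_gt0.
have sd : s <= d / 2 by rewrite ge_min lexx.
have s1 : s <= 1 by rewrite !ge_min lexx orbT.
have sF : k * s <= F 0 / 2 by rewrite -ler_pdivlMl// mulrC !ge_min lexx !orbT.
have := Fd s; rewrite /ball /= sub0r normrN gtr0_norm// => /(_ _)/wrap[].
  by rewrite (le_lt_trans sd)// ltr_pdivrMr// ltr_pMr// ltr1n.
rewrite ltr_norml => /andP[_ Fs].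
have := FG s; rewrite gt_eqF// gtr0_norm// => /(_ isT).
have := @ge1r_powR R s e; rewrite s0 s1 => /(_ isT e1).
by rewrite -(ler_pM2l k0); lra.
Qed.

Section bubbles.
Context {R : realType} {N : nat}.
Variables (a : R) (x0 : 'rV[R]_N).
Hypotheses (a0 : 0 < a).
Let w : 'rV[R]_N -> R := fun x => a * \1_(eball x0 1) x.

(** The ball has finite measure because [w] vanishes at infinity, and it is
    measurable because [w] is. *)
Lemma functional_bubble_fin (e : R) : e != 0 -> BVdot R N w ->
  (functional (fun s : R => (`|s| `^ e)%R) w < +oo)%E.
Proof.
move=> e0 [mw vw _ _].
have mB : measurable (eball x0 1 : set (Rn R N)).
  have -> : eball x0 1 = setT `&` w @^-1` `]0, +oo[.
    apply/seteqP; split => [x Bx|x [_]].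
      by split=> //=; rewrite in_itv/= andbT /w indicE mem_set// mulr1.
    rewrite /= in_itv/= andbT /w indicE; case: (boolP (_ \in _)).
      by rewrite inE.
    by rewrite mulr0 ltxx.
  by apply: mw.
have B_fin : (@lebesgue_Rn R N (eball x0 1) < +oo)%E.
  apply: le_lt_trans (vw (a / 2) _); last by rewrite divr_gt0.
  apply: le_lebesgue_outer => x Bx /=; rewrite /w indicE mem_set// mulr1.
  by rewrite gtr0_norm// ltr_pdivrMr// ltr_pMr// ltr1n.
have ae0 : 0 < a `^ e by exact: powR_gt0.
have := integral_pZl_nonmeas (@lebesgue_Rn R N)
  (fun x => (\1_(eball x0 1) x)%:E) ae0.
rewrite integral_indic// setIT => wE.
rewrite (_ : functional _ _ = (\int[@lebesgue_Rn R N]_x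
    ((a `^ e)%:E * (\1_(eball x0 1) x)%:E))%E).
  by rewrite wE lte_mul_pinfty// lee_fin ltW.
apply: eq_integral => x _; rewrite -EFinM /w indicE; case: (_ \in _).
  by rewrite !mulr1 gtr0_norm.
by rewrite !mulr0 normr0 powR0.
Qed.

(** The dilation sending the ball [B(x1, r)] to the unit ball has ratio [r^-1]. *)
Lemma rescale_bubble (s r : R) (x1 : 'rV[R]_N) : (0 < N)%N -> 0 < r ->
  rescale s r^-1 x1 x0 w = (fun x => s * bubble a x1 r x).
Proof.
move=> N0 r0; apply/funext => x; rewrite /rescale /bubble /w.
have -> : r `^ (1 - N%:R) = r^-1 ^+ N.-1.
  have -> : 1 - N%:R = - N.-1%:R :> R by rewrite -[in LHS](prednK N0) mulrSr; lra.
  by rewrite powRN powR_mulrn ?ltW// exprVn.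
rewrite !mulrA; congr (_ * _); rewrite !indicE; congr ((_ : bool)%:R).
have iff : eball x0 1 (dilation r^-1 x1 x0 x) <-> eball x1 r x.
  by rewrite /eball /= enorm_dilation ?invr_gt0// ltr_pdivrMl// mulr1.
by apply/idP/idP; rewrite !inE => /iff.
Qed.

Lemma bubble_height (t : R) : 0 < N%:R - 1 :> R -> 0 < t ->
  ((a / t) `^ (N%:R - 1)^-1) `^ (1 - N%:R) * a = t.
Proof.
move=> N1 t0; rewrite -powRrM -(opprB N%:R 1) mulrN mulVf ?gt_eqF// powR_inv1.
  by rewrite invf_div divfK// gt_eqF.
by rewrite divr_ge0// ltW.
Qed.

(** The sign [s] treats positive and negative contact points [s t] at once. *)
Lemma is_maximizer_bubble (x1 : 'rV[R]_N) (s t : R) (F : R -> R) (m : R) :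
  (2 <= N)%N -> is_maximizer (fun s : R => `|s| `^ crit_exp R N) w ->
  continuous F -> 0 < m -> (forall s, s != 0 -> F s <= m * `|s| `^ crit_exp R N) ->
  s ^+ 2 = 1 -> 0 < t -> F (s * t) = m * t `^ crit_exp R N ->
  is_maximizer F (fun x => s * bubble a x1 ((a / t) `^ (N%:R - 1)^-1) x).
Proof.
move=> N2 [Sw Mw] F_cont m0 FG s2 t0 Ft; have N0 : (0 < N)%N by exact: ltnW.
have N1 : 0 < N%:R - 1 :> R by rewrite subr_gt0 ltr1n.
set r := _ `^ _; have r0 : 0 < r by rewrite powR_gt0// divr_gt0.
set p := crit_exp R N in Mw FG Ft *.
have p1 : 1 <= p by exact: crit_exp_ge1.
have p0 : p != 0 by rewrite gt_eqF// (lt_le_trans ltr01).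
pose G := fun x : R => m * `|x| `^ p.
have G0 : G 0 = 0 by rewrite /G normr0 powR0// mulr0.
rewrite -rescale_bubble//; set u := rescale _ _ _ _ _.
have Mu : is_maximizer G u.
  apply: is_maximizer_pZl => //; split.
    by apply: BVdot_sphere_rescale => //; rewrite invr_gt0.
  by rewrite -Mw functional_pow_rescale// invr_gt0.
have u_fin : (functional G u < +oo)%E.
  rewrite /functional; under eq_integral do rewrite EFinM.
  rewrite integral_pZl_nonmeas// lte_mul_pinfty ?lee_fin ?ltW//.
  rewrite [ltLHS](functional_pow_rescale N2 x1 x0 w s2) ?invr_gt0//.
  by apply: functional_bubble_fin => //; case: Sw.
apply: (is_maximizer_contact (G := G)) => //.
- by move=> x; rewrite mulr_ge0 ?powR_ge0// ltW.
- move=> x; have [->|/FG//] := eqVneq x 0.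
  by rewrite G0; exact: le0_of_le_mul_powR FG.
- move=> x; rewrite /u rescale_bubble// /bubble bubble_height//.
  rewrite indicE; case: (_ \in _); last by rewrite !mulr0 eqxx.
  rewrite mulr1 Ft /G normrM (gtr0_norm t0) => _.
  suff -> : `|s| = 1 by rewrite mul1r.
  by apply/eqP; rewrite -sqrp_eq1// real_normK ?num_real// s2.
Qed.

End bubbles.

Unset Implicit Arguments.
Set Strict Implicit.

Theorem theorem5p1 (R : realType) (N : nat) (hN : (2 <= N)%N)
  (a : R) (ha : 0 < a) (x0 : 'rV[R]_N)
  (hw : is_maximizer (fun s : R => `|s| `^ crit_exp R N)
          (fun x => a * \1_(eball x0 1) x))
  (F : R -> R) (hF : continuous F) (m t : R) (hm : 0 < m)
  (hsup : m%:E = ereal_sup [set (F s / `|s| `^ crit_exp R N)%:E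
                           | s in [set s : R | s != 0]])
  (ht0 : t != 0) (ht : F t / `|t| `^ crit_exp R N = m)
  (x1 : 'rV[R]_N) :
  (0 < t -> is_maximizer F (bubble a x1 ((a / t) `^ (N%:R - 1)^-1))) /\
  (t < 0 -> is_maximizer F (fun x => - bubble a x1 ((a / - t) `^ (N%:R - 1)^-1) x)).
Proof.
have FG s : s != 0 -> F s <= m * `|s| `^ crit_exp R N.
  move=> s0; rewrite -ler_pdivrMr; last by rewrite powR_gt0 ?normr_gt0.
  by rewrite -lee_fin hsup; apply: ereal_sup_ubound; exists s.
have Ft : F t = m * `|t| `^ crit_exp R N.
  by rewrite -ht divfK// gt_eqF// powR_gt0 ?normr_gt0.
split=> [t_gt0|t_lt0].
  have := is_maximizer_bubble ha x1 hN hw hF hm FG (expr1n _ 2) t_gt0.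
  rewrite mul1r Ft (gtr0_norm t_gt0) => /(_ erefl); congr is_maximizer.
  by apply/funext => x; rewrite mul1r.
have t_gt0 : 0 < - t by rewrite oppr_gt0.
have := @is_maximizer_bubble R N a x0 ha x1 (-1) (- t) F m hN hw hF hm FG _ t_gt0.
rewrite sqrrN expr1n mulN1r opprK Ft (ltr0_norm t_lt0) => /(_ erefl erefl).
by congr is_maximizer; apply/funext => x; rewrite mulN1r.
Qed.
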